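(* Let $X$ be a Tychonoff space and let $\aleph_\alpha\geq\aleph_1$ be a cardinal. The following statements are equivalent: (1) $X$ is $\aleph_\alpha$-separable. (2) $C_{\aleph_\alpha}(X)=C_u(X)$ (the two topologies on $C(X)$ coincide). (3) $C_{\aleph_\alpha}(X)$ is metrizable by a complete metric. (4) $C_{\aleph_\alpha}(X)$ is first countable. (5) $C_{\aleph_\alpha}(X)$ is a Fréchet–Urysohn space. (6) $C_{\aleph_\alpha}(X)$ is a sequential space. (7) $C_{\aleph_\alpha}(X)$ is countably tight.
   Context: Tychonoff means completely regular and Hausdorff. The density of $X$ is $d(X)=\aleph_0+\min\{|D|: D \text{ dense in } X\}$; $X$ is $\aleph_\alpha$-separable if $d(X)<\aleph_\alpha$. $C(X)$ is the set of all real-valued continuous functions on $X$. For $f\in C(X)$, $A\subseteq X$ and real $\epsilon>0$ put $B(f,A,\epsilon)=\{g\in C(X): \sup_{x\in A}|f(x)-g(x)|<\epsilon\}$ (equal to $C(X)$ when $A=\emptyset$). For an infinite cardinal $\aleph_\alpha$, $C_{\aleph_\alpha}(X)$ is $C(X)$ with the topology having as base all sets $B(f,A,\epsilon)$ with $f\in C(X)$, $\epsilon>0$ and $A\subseteq X$, $|A|<\aleph_\alpha$. $C_u(X)$ is $C(X)$ with the topology of uniform convergence, in which the sets $B(f,X,\epsilon)$, $\epsilon>0$, form a neighborhood base at $f$. A space $Y$ is Fréchet–Urysohn if whenever $A\subseteq Y$ and $y\in\overline{A}$ there is a sequence in $A$ converging to $y$; sequential if every subset containing the limits of all convergent sequences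 lying in it is closed; countably tight if whenever $A\subseteq Y$ and $y\in\overline{A}$ there is a countable $B\subseteq A$ with $y\in\overline{B}$. *)

(* Defs.v *)
From HB Require Import structures.
From mathcomp Require Import all_boot all_order all_algebra.
From mathcomp Require Import finmap.
From mathcomp Require Import all_classical all_reals all_analysis.
From mathcomp Require Import zify.

Set Implicit Arguments.
Unset Strict Implicit.
Unset Printing Implicit Defensive.

Import Order.TTheory GRing.Theory Num.Theory.
Import numFieldNormedType.Exports.

Local Open Scope classical_set_scope.
Local Open Scope ring_scope.
Local Open Scope card_scope.

Definition card_lt T U (A : set T) (B : set U) := (A #<= B) && ~~ (B #<= A).

Lemma inj_subset_card_le T U (A : set T) (B : set U) (f : T -> U) :
  f @` A `<=` B -> {in A &, injective f} -> A #<= B.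
Proof.
move=> fAB finj; have /card_eqPle[_ Af] := inj_card_eq finj.
exact: card_le_trans Af (subset_card_le fAB).
Qed.

Lemma card_le_fun T U (A : set T) (B : set U) : B !=set0 -> A #<= B ->
  exists2 f : T -> U, f @` A `<=` B & {in A &, injective f}.
Proof.
elim/Ppointed: U => U in B *; first by rewrite emptyE => -[].
move=> _ /pcard_leP/injfunPex[f fAB finj]; exists f => //.
by move=> _ [x Ax <-]; exact: fAB.
Qed.

Lemma card_min_exists T (S : set (set T)) : S !=set0 ->
  exists D, S D /\ forall E, S E -> D #<= E.
Proof.
move=> [D0 SD0].
pose P (G : set (set T -> T)) :=
  (forall s, G s -> forall D, S D -> D (s D)) /\
  (forall s t D, G s -> G t -> S D -> s D = t D -> s = t).
have [F FP Ftot|G [[GD Ginj] Gmax]] := @Zorn_bigcup _ P.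
  split=> [s [G FG Gs] D SD|s t D [G FG Gs] [H FH Ht] SD st].
    by have [GD _] := FP _ FG; exact: GD Gs D SD.
  have [GH|HG] := Ftot _ _ FG FH.
    by have [_ Hinj] := FP _ FH; exact: Hinj (GH _ Gs) Ht SD st.
  by have [_ Ginj] := FP _ FG; exact: Ginj Gs (HG _ Ht) SD st.
have [D [SD DG]] : exists D, S D /\ D `<=` (fun s => s D) @` G.
  apply: contrapT => noD.
  have out D : exists x, S D -> D x /\ forall s, G s -> s D <> x.
    have [SD|nSD] := pselect (S D); last first.
      have [[x _]|T0] := pselect (exists x, D0 x); first by exists x => /nSD.
      by case: noD; exists D0; split => // x D0x; case: T0; exists x.
    apply: contrapT => nx; apply: noD; exists D; split => // x Dx.
    apply: contrapT => nGx; apply: nx; exists x => _; split => // s Gs sx.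
    by apply: nGx; exists s.
  have [r rP] := choice out.
  apply: (Gmax (G `|` [set r])).
    split; first by left.
    move=> /(_ r (or_intror erefl)) Gr.
    by have [_ /(_ r Gr)] := rP _ SD0.
  split=> [s [Gs|->] D SD|s t D [Gs|->] [Gt|->] SD st //].
  - exact: (GD s Gs).
  - by have [] := rP _ SD.
  - exact: Ginj st.
  - by have [_ /(_ _ Gs)] := rP _ SD.
  - by have [_ /(_ _ Gt)] := rP _ SD; rewrite st.
exists D; split => // E SE.
have DG' := card_le_trans (subset_card_le DG) (card_image_le _ _).
apply: (card_le_trans DG'); apply: (@inj_subset_card_le _ _ _ _ (fun s => s E)).
  by move=> _ [s Gs <-]; exact: (GD s Gs).
by move=> s t; rewrite !inE => Gs Gt; exact: (Ginj s t E).
Qed.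

Lemma card_le_total T (A B : set T) : A #<= B \/ B #<= A.
Proof.
have [|D [[->|->] DP]] := @card_min_exists _ [set A; B]; first by exists A; left.
  by left; apply: DP; right.
by right; apply: DP; left.
Qed.

Lemma card_setU_le T (A B : set T) :
  infinite_set B -> A #<= B -> A `|` B #<= B.
Proof.
move=> Binf AB.
pose P (F : set (nat -> T)) := (forall g n, F g -> B (g n)) /\
  (forall g h n m, F g -> F h -> g n = h m -> g = h /\ n = m).
have [C CP Ctot|F [[FB Finj] Fmax]] := @Zorn_bigcup _ P.
  split=> [g n [G CG Gg]|g h n m [G CG Gg] [H CH Hh] gh].
    by have [GB _] := CP _ CG; exact: GB Gg.
  have [GH|HG] := Ctot _ _ CG CH.
    by have [_ Hinj] := CP _ CH; exact: Hinj (GH _ Gg) Hh gh.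
  by have [_ Ginj] := CP _ CG; exact: Ginj Gg (HG _ Hh) gh.
pose Q := [set x | B x /\ forall g n, F g -> g n <> x].
have Qfin : finite_set Q.
  apply: contrapT => /infiniteP Qinf.
  have [|r rQ rinj] := card_le_fun _ Qinf.
    by apply/set0P/eqP => Q0; move: Qinf; rewrite Q0; move/infiniteP; apply.
  have {}rQ n : Q (r n) by apply: rQ; exists n.
  have {}rinj n m : r n = r m -> n = m by apply: rinj; rewrite inE.
  apply: (Fmax (F `|` [set r])).
    split; first by left.
    move=> /(_ r (or_intror erefl)) Fr.
    by have [_ /(_ r 0%N Fr)] := rQ 0%N.
  split=> [g n [Fg|->]|g h n m [Fg|->] [Fh|->] gh].
  - exact: FB.
  - by have [] := rQ n.
  - exact: Finj.
  - by have [_ /(_ _ n Fg)] := rQ m.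
  - by have [_ /(_ _ m Fh)] := rQ n; rewrite gh.
  - by split => //; exact: rinj.
have [g0 Fg0] : exists g, F g.
  apply: contrapT => nF; apply: Binf; apply: sub_finite_set Qfin => x Bx.
  by split => // g n Fg; case: nF; exists g.
have [|q _ qinj] := @card_le_fun _ nat Q setT _ (finite_set_countable Qfin).
  by exists 0%N.
have [p [pB pinj]] : exists p : T -> bool -> T, (forall x b, B x -> B (p x b)) /\
    (forall x y b c, B x -> B y -> p x b = p y c -> x = y /\ b = c).
  have ex x : exists y : bool -> T, B x -> (Q x /\ forall b : bool, y b = g0 (q x * 4 + 2 + b)%N)
      \/ exists g n, [/\ F g, x = g n & forall b : bool, y b = g (n * 4 + b)%N].
    have [Bx|] := pselect (B x); last by exists (fun=> x).
    have [[g [n [Fg xg]]]|nx] := pselect (exists g n, F g /\ x = g n).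
      by exists (fun b : bool => g (n * 4 + b)%N) => _; right; exists g, n.
    exists (fun b : bool => g0 (q x * 4 + 2 + b)%N) => _; left; split => //.
    by split => // g n Fg gx; apply: nx; exists g, n.
  have [p pP] := choice ex; exists p; split.
    move=> x b /pP[[_ ->]|[g [n [Fg _ ->]]]]; exact: FB.
  move=> x y b c /pP px /pP py.
  case: px => [[Qx ->]|[g [n [Fg -> ->]]]]; case: py => [[Qy ->]|[h [m [Fh -> ->]]]].
  - move=> /(Finj _ _ _ _ Fg0 Fg0)[_ e].
    have [qxy bc] : q x = q y /\ b = c by case: b c e => -[] e; split; lia.
    by split => //; apply: qinj; rewrite ?inE.
  - by move=> /(Finj _ _ _ _ Fg0 Fh)[_ e]; exfalso; case: b c e => -[]; lia.
  - by move=> /(Finj _ _ _ _ Fg Fg0)[_ e]; exfalso; case: b c e => -[]; lia.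
  - move=> /(Finj _ _ _ _ Fg Fh)[-> e].
    by have [-> ->] : n = m /\ b = c by case: b c e => -[] e; split; lia.
have [|f fAB finj] := card_le_fun _ AB; first exact: infinite_setN0.
pose k x := if x \in B then p x true else p (f x) false.
have Bf x : A x -> B (f x) by move=> Ax; apply: fAB; exists x.
apply: (@inj_subset_card_le _ _ _ _ k).
  move=> _ [x ABx <-]; rewrite /k; case: ifPn => [|]; rewrite ?inE ?notin_setE.
    exact: pB.
  by move=> Bx; case: ABx => // /Bf; exact: pB.
move=> x y; rewrite !inE /k => ABx ABy.
case: ifPn; rewrite ?inE ?notin_setE => Bx; case: ifPn; rewrite ?inE ?notin_setE => By.
- by move=> /(pinj _ _ _ _ Bx By)[].
- by case: ABy => // /Bf fy /(pinj _ _ _ _ Bx fy)[].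
- by case: ABx => // /Bf fx /(pinj _ _ _ _ fx By)[].
- case: ABx => // Ax; case: ABy => // Ay.
  move=> /(pinj _ _ _ _ (Bf _ Ax) (Bf _ Ay))[+ _].
  by apply: finj; rewrite inE.
Qed.

Lemma card_lt_setU T U (A B : set T) (K : set U) : infinite_set K ->
  card_lt A K -> card_lt B K -> card_lt (A `|` B) K.
Proof.
move=> Kinf; wlog AB : A B / A #<= B => [H ltA ltB|].
  have [AB|BA] := card_le_total A B; first exact: H.
  by rewrite setUC; exact: H.
move=> /andP[AK _] /andP[BK KB].
have [Bfin|Binf] := pselect (finite_set B).
  have ABfin : finite_set (A `|` B).
    by rewrite finite_setU; split => //; exact: card_le_finite Bfin.
  apply/andP; split.
    move/infiniteP: Kinf; apply: card_le_trans; exact: finite_set_countable.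
  by apply/negP => /card_le_finite /(_ ABfin).
have ABB := card_setU_le Binf AB.
apply/andP; split; first exact: card_le_trans ABB BK.
by apply: contra KB => /card_le_trans; exact.
Qed.

Definition tychonoff_space (X : topologicalType) :=
  completely_regular_space X /\ hausdorff_space X.

Section density.
Variable X : topologicalType.

Lemma min_dense_exists :
  exists D : set X, dense D /\ forall E : set X, dense E -> D #<= E.
Proof.
by apply: (@card_min_exists _ (@dense X)); exists setT => O O0 _; rewrite setIT.
Qed.

Definition min_dense : set X := sval (cid min_dense_exists).

(* The cardinal aleph_0 + |min_dense|, represented by a disjoint union *)
Definition density : set (nat + X) := range inl `|` inr @` min_dense.

(* A cardinal kappa is represented by a type K of that cardinality; under the
   axiom of choice, the alephs are the cardinals of the infinite types. *)
Definition card_separable (K : Type) := card_lt density [set: K].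

End density.

Section function_spaces.
Variables (X : topologicalType) (R : realType).
Implicit Types (f g h : continuousType X R) (A B : set X) (e : R).

(* In \bar R, the supremum of the empty set is -oo, and that of an unbounded
   set is +oo *)
Definition Cball f A e : set (continuousType X R) :=
  [set g | (ereal_sup [set `|f x - g x|%:E | x in A] < e%:E)%E].

Lemma CballP f A e g : 0 < e -> Cball f A e g <->
  exists d, [/\ 0 <= d, d < e & forall x, A x -> `|f x - g x| <= d].
Proof.
move=> e0; split=> [|[d [_ de fgd]]]; last first.
  rewrite /Cball/=; apply: (@le_lt_trans _ _ d%:E); last by rewrite lte_fin.
  by apply: ge_ereal_sup => _ [x Ax <-]; rewrite lee_fin; exact: fgd.
rewrite /Cball/=; set S := (X in ereal_sup X) => Se.
have Sub x : A x -> (`|f x - g x|%:E <= ereal_sup S)%E.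
  by move=> Ax; apply: ereal_sup_ubound; exists x.
have [[a Aa]|A0] := pselect (A !=set0); last first.
  by exists 0; split => // x Ax; case: A0; exists x.
case: (ereal_sup S) Se Sub => [r| |] //=.
  rewrite lte_fin => re Sr; exists r; split => //.
    by have := Sr _ Aa; rewrite lee_fin; apply: le_trans.
  by move=> _ /(_ _ Aa).
Qed.

Lemma Cball_center f A e : 0 < e -> Cball f A e f.
Proof.
by move=> e0; apply/CballP => //; exists 0; split => // x _; rewrite subrr normr0.
Qed.

Lemma Cball_sub f A e g : 0 < e -> Cball f A e g ->
  exists2 e', 0 < e' & Cball g A e' `<=` Cball f A e.
Proof.
move=> e0 /CballP[//|d [d0 de fgd]]; exists (e - d); rewrite ?subr_gt0// => h.
move=> /CballP[|d' [d'0 d'e ghd]]; first by rewrite subr_gt0.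
apply/CballP => //; exists (d + d'); split; first exact: addr_ge0.
  by rewrite addrC -ltrBrDr.
by move=> x Ax; rewrite (le_trans (ler_distD (g x) _ _))// lerD ?fgd ?ghd.
Qed.

Lemma Cball_subset f A B e e' : A `<=` B -> 0 < e' -> e' <= e ->
  Cball f B e' `<=` Cball f A e.
Proof.
move=> AB e'0 e'e g /CballP[//|d [d0 de fgd]].
apply/CballP; first exact: lt_le_trans e'e.
exists d; split => //; first exact: lt_le_trans e'e.
by move=> x /AB; exact: fgd.
Qed.

(* C(X) with the topology generated by the sets Cball f A e with |A| < kappa,
   where the cardinal kappa is represented by K; C_card_basis below shows that
   they form a base when kappa is infinite. *)
Definition C_card (K : Type) : Type := continuousType X R.

Definition C_card_base (K : Type) : set (set (C_card K)) :=
  [set U | exists f A e, [/\ 0 < e, card_lt A [set: K] & U = Cball f A e]].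

HB.instance Definition _ (K : Type) := gen_eqMixin (C_card K).
HB.instance Definition _ (K : Type) := gen_choiceMixin (C_card K).
HB.instance Definition _ (K : Type) :=
  isSubBaseTopological.Build (C_card K) (@C_card_base K) id.

Definition C_unif : Type := continuousType X R.

Definition C_unif_nbhs (f : C_unif) : set_system C_unif :=
  filter_from [set e : R | 0 < e] (Cball f setT).

HB.instance Definition _ := gen_eqMixin C_unif.
HB.instance Definition _ := gen_choiceMixin C_unif.
HB.instance Definition _ := hasNbhs.Build C_unif C_unif_nbhs.

Lemma C_unif_nbhs_filter (f : C_unif) : ProperFilter (nbhs f).
Proof.
apply: filter_from_proper => [|e /= e0]; last by exists f; exact: Cball_center.
apply: filter_from_filter => [|e e' /= e0 e'0]; first by exists 1 => /=.
exists (Num.min e e') => /=; first by rewrite lt_min e0.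
by rewrite subsetI; split; apply: Cball_subset;
  rewrite ?lt_min ?e0 ?ge_min ?lexx ?orbT.
Qed.

Lemma C_unif_nbhs_singleton (f : C_unif) (U : set C_unif) : nbhs f U -> U f.
Proof. by move=> [e e0]; apply; exact: Cball_center. Qed.

Lemma C_unif_nbhs_nbhs (f : C_unif) (U : set C_unif) :
  nbhs f U -> nbhs f (nbhs^~ U).
Proof.
move=> [e e0 feU]; exists e => // g /(Cball_sub e0)[e' e'0 gfe].
by exists e' => //; exact: subset_trans gfe feU.
Qed.

HB.instance Definition _ := Nbhs_isNbhsTopological.Build C_unif
  C_unif_nbhs_filter C_unif_nbhs_singleton C_unif_nbhs_nbhs.

End function_spaces.

Lemma C_card_basis (X : topologicalType) (R : realType) (K : Type) :
  infinite_set [set: K] -> basis (@C_card_base X R K).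
Proof.
move=> Kinf; split=> [U KU|f U].
  exists [set U] => [_ ->|]; last by rewrite bigcup_set1.
  exact: finI_from1.
have -> : nbhs f = [set V | exists2 O, open_nbhs f O & O `<=` V] by exact: nbhsE.
move=> [_ [[D Dfin <-] [W DW Wf]] DU].
have [F FK FW] := Dfin _ DW; rewrite -FW in DW Wf.
have FB V : V \in F -> C_card_base V /\ V f.
  by move=> FV; split; [exact: set_mem (FK _ FV) | exact: Wf].
have [A [e [e0 ltA AeF]]] : exists A e, [/\ 0 < e, card_lt A [set: K] &
    forall g, Cball f A e g -> forall V, V \in F -> V g].
  suff : forall s : seq (set (C_card X R K)),
      (forall V, V \in s -> C_card_base V /\ V f) ->
      exists A e, [/\ 0 < e, card_lt A [set: K] &
        forall g, Cball f A e g -> forall V, V \in s -> V g].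
    by move=> /(_ (enum_fset F) FB).
  elim=> [_|V s IHs sK].
    exists set0, 1; split=> //.
    rewrite /card_lt card_ge0/=; apply/negP => /card_le_finite/(_ (finite_set0 _)).
    exact: Kinf.
  have [|A [e [e0 ltA Aes]]] := IHs.
    by move=> V' V's; apply: sK; rewrite inE V's orbT.
  have [[g [B [d [d0 ltB ->]]]] /(Cball_sub d0)[d' d'0 fBd']] := sK V (mem_head _ _).
  exists (A `|` B), (Num.min e d'); split.
  - by rewrite lt_min e0.
  - exact: card_lt_setU.
  - move=> h ABh V'; rewrite inE => /predU1P[->|V's].
      by apply: fBd'; apply: Cball_subset ABh; rewrite ?lt_min ?e0 ?ge_min ?lexx ?orbT.
    apply: Aes V's; apply: Cball_subset ABh;
      by rewrite ?lt_min ?e0 ?ge_min ?lexx ?orbT.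
exists (Cball f A e); last first.
  by apply: subset_trans DU => h /AeF hF; exists (\bigcap_(V in [set` F]) V).
by split; [exists f, A, e | exact: Cball_center].
Qed.

Section topological_properties.
Variable Y : topologicalType.

Definition first_countable := forall y : Y, exists B : set (set Y),
  [/\ countable B, B `<=` nbhs y &
      forall U, nbhs y U -> exists2 V, B V & V `<=` U].

Definition frechet_urysohn := forall (A : set Y) (y : Y), closure A y ->
  exists2 u : nat -> Y, (forall n, A (u n)) & u @ \oo --> y.

Definition sequential := forall A : set Y,
  (forall (u : nat -> Y) (y : Y), (forall n, A (u n)) -> u @ \oo --> y -> A y) ->
  closed A.

Definition countably_tight := forall (A : set Y) (y : Y), closure A y ->
  exists B : set Y, [/\ B `<=` A, countable B & closure B y].

(* M carries its own topology, hence the first conjunct; in a metric space,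
   completeness for sequences is completeness *)
Definition completely_metrizable (R : realType) :=
  exists m : Metric.axioms_ R Y, let M : metricType R := Metric.Pack m in
    (forall y : Y, @nbhs M M y = @nbhs Y Y y) /\
    (forall u : nat -> M, cauchy (u @ \oo) -> exists l : M, u @ \oo --> l).

End topological_properties.

(* Main.v *)
From HB Require Import structures.
Require Import Defs.
From mathcomp Require Import all_boot all_order all_algebra.
From mathcomp Require Import all_classical all_reals all_analysis.
From mathcomp Require Import lra.
Import Order.TTheory GRing.Theory Num.Theory.
Import numFieldNormedType.Exports.
Local Open Scope classical_set_scope.

(* (1) => (2): uniform closeness on a dense set is uniform closeness on X.
   (2) => (3): C_u(X) is metrized by sup min(1, |f - g|), and a uniform limit
   of continuous functions is continuous. (3) => (4) => (5) => (6) => (7) hold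
   in every topological space. (7) => (1): if no set of cardinality < |K| is
   dense, complete regularity puts the zero function in the closure of
   { f | f takes the value 1 }. Countably many such functions f_n, with
   f_n(x_n) = 1, never accumulate at zero, because {x_n} is countable, hence of
   cardinality < |K|. *)

(** * Countability properties of arbitrary spaces *)

Section countability.
Local Open Scope ring_scope.

Lemma completely_metrizable_first_countable (R : realType)
    (Y : topologicalType) :
  completely_metrizable Y R -> first_countable Y.
Proof.
move=> [m /= [mE _]] y; pose M : metricType R := Metric.Pack m.
exists (range (fun n : nat => @ball R M y n.+1%:R^-1)); split.
- exact: card_image_le.
- move=> _ [n _ <-]; rewrite -mE.
  by apply: (@nbhsx_ballx R M); rewrite invr_gt0 ltr0n.
- move=> U; rewrite -mE => /(@nbhs_ballP R M)[e /= e0 eU].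
  have [n _ /(_ n (leqnn n)) /= ne] := near_infty_natSinv_lt (PosNum e0).
  exists (@ball R M y n.+1%:R^-1); first by exists n.
  by apply: subset_trans eU; exact: (@le_ball R M y _ _ (ltW ne)).
Qed.

Lemma first_countable_frechet_urysohn (Y : topologicalType) :
  first_countable Y -> frechet_urysohn Y.
Proof.
move=> Y1 A y Ay; have [B [Bcount By Bbase]] := Y1 y.
have [B0|[V]] := pfcard_geP Bcount.
  by have [V] := Bbase _ (@filterT _ (nbhs y) _); rewrite B0.
have VB n : nbhs y (V n) by apply: By; exact: funS.
(* The sets [V i] need not decrease; a point chosen in the intersection of the first [n + 1] of them
   lies in [V i] for every [i <= n], so the chosen points are eventually in each [V i]. *)
have W n : nbhs y [set z | forall i, (i <= n)%N -> V i z].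
  elim: n => [|n IHn]; first by apply: filterS (VB 0%N) => z ? i; case: i.
  apply: filterS2 (VB n.+1) IHn => z Vz zn i.
  by rewrite leq_eqVlt => /predU1P[->|/zn].
have ex n : exists z, A z /\ forall i, (i <= n)%N -> V i z.
  by have [z []] := Ay _ (W n); exists z.
have [u uP] := choice ex; exists u => [n|U Uy]; first by have [] := uP n.
have [_ /(@surj _ _ _ _ V)[i _ <-] ViU] := Bbase _ Uy.
by exists i => // n /= ni; apply: ViU; have [_] := uP n; exact.
Qed.

Lemma frechet_urysohn_sequential (Y : topologicalType) :
  frechet_urysohn Y -> sequential Y.
Proof. by move=> FU A Aseq y /FU[u uA uy]; exact: Aseq uA uy. Qed.

(** The points in closures of countable subsets of [A] form a sequentially closed set [C], since a
    countable union of countable sets is countable. So [C] is closed, and it contains [A]. *)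
Lemma sequential_countably_tight (Y : topologicalType) :
  sequential Y -> countably_tight Y.
Proof.
move=> Yseq A y.
pose C := [set z : Y | exists B, [/\ B `<=` A, countable B & closure B z]].
have /closure_id Cclosed : closed C.
  apply: Yseq => u z /choice[B BP] uz; exists (\bigcup_n B n); split.
  - by apply: bigcup_sub => n _; have [] := BP n.
  - by apply: bigcup_countable => // n _; have [] := BP n.
  - apply: (closed_cvg _ (@closed_closure _ _) _ _ uz); apply: nearW => n.
    by have [_ _] := BP n; apply: closureS; exact: bigcup_sup.
have AC : A `<=` C.
  move=> z Az; exists [set z]; split => [_ -> //||]; first exact: countable1.
  exact: subset_closure.
by move=> /(closureS AC); rewrite -Cclosed.
Qed.

End countability.

(** * A complete metric for uniform convergence *)

Section uniform_metric.
Local Open Scope ring_scope.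
Variables (X : topologicalType) (R : realType).

(** A separate alias, so that the topology induced by the metric does not clash with that of
    [C_unif]; [nbhs_C_metric] shows that they agree. *)
Definition C_metric : Type := continuousType X R.

HB.instance Definition _ := gen_eqMixin C_metric.
HB.instance Definition _ := gen_choiceMixin C_metric.

Implicit Types f g h : continuousType X R.

(* This is 0 if X is empty, because sup set0 = 0. *)
Definition sup_dist f g : R :=
  sup [set Num.min 1 `|f x - g x| | x in [set: X]].

Lemma sup_dist_le f g c : 0 <= c ->
  (forall x, Num.min 1 `|f x - g x| <= c) -> sup_dist f g <= c.
Proof.
move=> c0 fgc; rewrite /sup_dist; set S := (X in sup X).
have [->|/set0P S0] := eqVneq S set0; first by rewrite sup0.
by apply: ge_sup => // _ [x _ <-].
Qed.

Lemma min_le_sup_dist f g x : Num.min 1 `|f x - g x| <= sup_dist f g.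
Proof.
apply: ub_le_sup; last by exists x.
by exists 1 => _ [z _ <-]; rewrite ge_min lexx.
Qed.

Lemma sup_dist_ge0 f g : 0 <= sup_dist f g.
Proof.
have [[x _]|/nonemptyPn X0] := pselect ([set: X] !=set0).
  by apply: le_trans (min_le_sup_dist f g x); rewrite le_min ler01/=.
by rewrite /sup_dist X0 image_set0 sup0.
Qed.

(** Truncation at 1 is invisible at radii up to 1: a truncated value below 1 is the true
    distance. *)
Lemma Cball_sup_dist f g e : 0 < e -> e <= 1 ->
  Cball f setT e g <-> sup_dist f g < e.
Proof.
move=> e0 e1; split=> [/(CballP _ _ _ e0)[d [d0 de fgd]]|fge].
  apply: le_lt_trans de; apply: sup_dist_le => // x.
  by rewrite ge_min fgd// orbT.
apply/CballP => //; exists (sup_dist f g); split => // [|x _].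
  exact: sup_dist_ge0.
have := min_le_sup_dist f g x; rewrite ge_min => /orP[|//].
by move=> /le_lt_trans/(_ (lt_le_trans fge e1)); rewrite ltxx.
Qed.

Lemma sup_distxx f : sup_dist f f = 0.
Proof.
apply/le_anti; rewrite sup_dist_ge0 andbT; apply: sup_dist_le => // x.
by rewrite subrr normr0 ge_min lexx orbT.
Qed.

Lemma sup_dist_positivity f g : sup_dist f g = 0 -> f = g.
Proof.
move=> fg0; apply/continuousEP => x; apply/eqP; rewrite -subr_eq0 -normr_le0.
by have := min_le_sup_dist f g x; rewrite fg0 ge_min ler10.
Qed.

Lemma sup_dist_sym f g : sup_dist f g = sup_dist g f.
Proof.
rewrite /sup_dist; congr sup; apply: eq_imagel => x _.
by rewrite distrC.
Qed.

Lemma sup_dist_triangle g f h :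
  sup_dist f h <= sup_dist f g + sup_dist g h.
Proof.
apply: sup_dist_le => [|x]; first by rewrite addr_ge0 ?sup_dist_ge0.
apply: le_trans (lerD (min_le_sup_dist f g x) (min_le_sup_dist g h x)).
have := ler_distD (g x) (f x) (h x).
have := normr_ge0 (f x - g x); have := normr_ge0 (g x - h x).
(* If a truncation on the right equals 1, the sum is at least 1; otherwise the usual triangle
   inequality applies. *)
rewrite ge_min /Num.min; do 2 case: ifP => _; lra.
Qed.

HB.instance Definition _ := isMetric.Build R C_metric
  sup_distxx sup_dist_positivity sup_dist_sym sup_dist_triangle.

Lemma ball_C_metric f g e : 0 < e -> e <= 1 ->
  ball (f : C_metric) e (g : C_metric) <-> Cball f setT e g.
Proof.
by move=> e0 e1; rewrite ballEmdist/=; split => /Cball_sup_dist; exact.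
Qed.

Lemma nbhs_C_metric f :
  nbhs (f : C_metric) = nbhs (f : C_unif X R)
    :> set_system (continuousType X R).
Proof.
have m01 e : 0 < e -> 0 < Num.min 1 e :> R by move=> e0; rewrite lt_min ltr01.
have m1 e : Num.min 1 e <= 1 :> R by rewrite ge_min lexx.
apply/seteqP; split=> U.
  move=> /nbhs_ballP[e /= e0 eU]; exists (Num.min 1 e); first exact: m01.
  move=> g /(ball_C_metric _ _ _ (m01 _ e0) (m1 e)) fg; apply: eU.
  by apply: le_ball fg; rewrite ge_min lexx orbT.
move=> [e /= e0 eU]; apply/nbhs_ballP; exists (Num.min 1 e); first exact: m01.
move=> g /(ball_C_metric _ _ _ (m01 _ e0) (m1 e)) fg; apply: eU.
by apply: Cball_subset fg; rewrite ?m01// ge_min lexx orbT.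
Qed.

Lemma C_metric_complete (u : nat -> C_metric) :
  cauchy (u @ \oo) -> exists l : C_metric, u @ \oo --> l.
Proof.
move=> /cauchyP u_cauchy.
(* The centre [h] need not be a term of the sequence. The bound is non-strict so that it survives
   the pointwise limit in [near_g]. *)
have near_h e : 0 < e -> exists h : C_metric,
    \forall n \near \oo, forall x, `|h x - u n x| <= e.
  move=> e0; have m0 : 0 < Num.min 1 e by rewrite lt_min ltr01.
  have m1 : Num.min 1 e <= 1 by rewrite ge_min lexx.
  have [h hu] := u_cauchy _ m0; exists h.
  have {}hu : \forall n \near \oo, ball h (Num.min 1 e) (u n) := hu.
  apply: filterS hu => n /(ball_C_metric _ _ _ m0 m1).
  move=> /(CballP _ _ _ m0)[d [_ de hd]] x.
  by rewrite (le_trans (hd x I))// (le_trans (ltW de))// ge_min lexx orbT.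
have ptwise x : cvg ((u n x : R) @[n --> \oo]).
  apply/cauchy_cvgP/cauchyP => e e0.
  have [h hu] := near_h _ (divr_gt0 e0 (ltr0n R 2)); exists (h x).
  apply: filterS hu => n /(_ x) hux; rewrite /ball/=.
  by apply: le_lt_trans hux _; lra.
pose g x := lim ((u n x : R) @[n --> \oo]).
have near_g h e : (\forall n \near \oo, forall x, `|h x - u n x| <= e) ->
    forall x, `|h x - g x| <= e.
  move=> hu x.
  have hux : `|h x - u n x| @[n --> \oo] --> `|h x - g x|.
    by apply: cvg_norm; apply: cvgB; [exact: cvg_cst|exact: ptwise].
  apply: (cvgr_to_le hux); apply: filterS hu => n; exact.
have g_cts : continuous g.
  move=> x; apply/cvgrPdist_le => e e0.
  (* Thirds: [g] is compared with [h] at [x] and at [y], and [h x] with [h y]. *)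
  have [h /near_g hg] := near_h _ (divr_gt0 e0 (ltr0n R 3)).
  have /cvgrPdist_le /(_ _ (divr_gt0 e0 (ltr0n R 3))) := @cts_fun _ _ h x.
  apply: filterS => y /= hxy.
  have := hg x; have := hg y; move: hxy; rewrite !ler_norml; lra.
exists (mkcts g_cts : continuousType X R); apply/cvg_ballP => e e0.
have m0 : 0 < Num.min 1 e by rewrite lt_min ltr01.
have [h hu] := near_h _ (divr_gt0 m0 (ltr0n R 3)); have hg := near_g _ _ hu.
apply: filterS hu => n hun.
apply: (@le_ball _ _ _ (Num.min 1 e)); first by rewrite ge_min lexx orbT.
apply/ball_C_metric; rewrite ?ge_min ?lexx//.
(* Two thirds come from passing from [g] to [h] and from [h] to [u n]; the last third makes the
   inequality strict. *)
apply/CballP => //; exists (Num.min 1 e / 3 * 2); split; [lra|lra|].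
move=> x _ /=; have := hun x; have := hg x.
by rewrite /mkcts !ler_norml; lra.
Qed.

End uniform_metric.

(** * Cardinals below an uncountable one *)

Section cardinals.
Local Open Scope card_scope.

Lemma countable_card_lt T K (A : set T) :
  ~ countable [set: K] -> countable A -> card_lt A [set: K].
Proof.
move=> Kunc Acount; apply/andP; split.
  apply: (card_le_trans Acount); apply/infiniteP => Kfin; apply: Kunc.
  exact: finite_set_countable.
by apply/negP => KA; apply: Kunc; exact: card_le_trans KA Acount.
Qed.

Lemma card_le_lt T U V (A : set T) (B : set U) (C : set V) :
  A #<= B -> card_lt B C -> card_lt A C.
Proof.
move=> AB /andP[BC CB]; apply/andP; split; first exact: card_le_trans AB BC.
by apply: contra CB => /card_le_trans; exact.
Qed.

(* For uncountable K, the summand aleph_0 of the density is harmless. *)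
Lemma card_separableP (X : topologicalType) (K : Type) :
  ~ countable [set: K] ->
  card_separable X K <-> exists2 D : set X, dense D & card_lt D [set: K].
Proof.
move=> Kunc; have [Ddense Dmin] := svalP (cid (@min_dense_exists X)).
split=> [XK|[D /Dmin DD DK]].
  exists (@min_dense X) => //; apply: card_le_lt XK.
  apply: (@inj_subset_card_le _ _ _ _ inr) => [x Dx|x y _ _ [//]].
  by right.
apply: card_lt_setU.
- by move=> Kfin; apply: Kunc; exact: finite_set_countable.
- apply: countable_card_lt => //; exact: card_image_le.
- apply: card_le_lt DK; exact: card_le_trans (card_image_le _ _) DD.
Qed.

End cardinals.

(** * The topology of [C_card] and density of [X] *)

Section C_card.
Local Open Scope ring_scope.
Variables (X : topologicalType) (R : realType) (K : Type).
Hypothesis Kunc : ~ countable [set: K].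

(** A basic set containing [f] may be centred elsewhere; [Cball_sub] recentres it at [f] without
    changing [A]. *)
Lemma nbhs_C_cardP (f : continuousType X R) (U : set (continuousType X R)) :
  nbhs (f : C_card X R K) U <->
  exists A e, [/\ 0 < e, card_lt A [set: K] & Cball f A e `<=` U].
Proof.
have Kinf : infinite_set [set: K].
  by move=> Kfin; apply: Kunc; exact: finite_set_countable.
have [Copen Cbase] := @C_card_basis X R K Kinf.
split=> [/Cbase[_ [[g [A [e [e0 AK ->]]]] fA] AU]|[A [e [e0 AK AU]]]].
  have [e' e'0 fA'] := Cball_sub e0 fA.
  by exists A, e'; split => //; exact: subset_trans AU.
apply: (@filterS _ _ _ _ _ AU); apply: open_nbhs_nbhs.
split; last exact: Cball_center.
by apply: Copen; exists f, A, e.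
Qed.

(** The set where [f] and [g] differ by more than [e / 2] is open, so it would meet [D] if it were
    nonempty. *)
Lemma Cball_dense (f : continuousType X R) (D : set X) (e : R) : dense D ->
  0 < e -> Cball f D (e / 2) `<=` Cball f setT e.
Proof.
move=> Ddense e0 g /CballP[|d [d0 de fgd]]; first by rewrite divr_gt0.
apply/CballP => //; exists (e / 2); split; [lra|lra|move=> x _].
rewrite leNgt; apply/negP => fgx.
have ctsh : continuous (fun y => `|f y - g y|).
  by move=> y; apply: cvg_norm; apply: cvgB; exact: cts_fun.
have [||y [/= fgy Dy]] := Ddense [set y | e / 2 < `|f y - g y|].
- by exists x.
- exact: (open_comp (fun y _ => ctsh y) (@open_gt _ (e / 2))).
- by have := fgd _ Dy; rewrite leNgt (lt_trans de).
Qed.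

Lemma separable_open_C_card : card_separable X K ->
  @open (C_card X R K) = @open (C_unif X R) :> set (set (continuousType X R)).
Proof.
move=> /(card_separableP _ _ Kunc)[D Ddense DK].
have nbhsE (f : continuousType X R) (U : set (continuousType X R)) :
    nbhs (f : C_card X R K) U <-> nbhs (f : C_unif X R) U.
  rewrite nbhs_C_cardP; split=> [[A [e [e0 _ AU]]]|[e /= e0 eU]].
    by exists e => //; apply: subset_trans AU; exact: Cball_subset.
  exists D, (e / 2); split => //; first by rewrite divr_gt0.
  by apply: subset_trans eU; exact: Cball_dense.
apply/seteqP; split=> U; rewrite !openE => oU f Uf; apply/nbhsE; exact: oU.
Qed.

Lemma open_C_card_completely_metrizable :
  @open (C_card X R K) = @open (C_unif X R) :> set (set (continuousType X R)) ->
  completely_metrizable (C_card X R K) R.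
Proof.
move=> openE; exists (Metric.class (C_metric X R)); split => [f|u].
  (* Neighbourhoods are rewritten through open sets, where the assumed equality applies. *)
  rewrite [LHS]nbhs_C_metric !nbhsE /open_nbhs.
  by rewrite openE.
exact: C_metric_complete.
Qed.

Lemma countably_tight_separable : tychonoff_space X ->
  countably_tight (C_card X R K) -> card_separable X K.
Proof.
move=> [creg _] tight; apply/card_separableP => //; apply: contrapT => nosep.
pose zero : continuousType X R := mkcts (@cst_continuous X R 0).
have zeroE x : zero x = 0 by [].
pose F := [set f : C_card X R K | exists x, f x = 1].
have zeroF : closure F (zero : C_card X R K).
  move=> U /nbhs_C_cardP[A [e [e0 AK AU]]].
  have /denseNE [V [[x [oV Vx]] VA]] : ~ dense A.
    by move=> Adense; apply: nosep; exists A.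
  have sepx := creg x (~` V) (open_closedC oV) (fun nVx => nVx Vx).
  pose f : X -> R := Urysohn [set x] (~` V).
  have fx0 : f x = 0 by apply: (Urysohn_sub0 sepx); exists x.
  have fV1 y : ~ V y -> f y = 1.
    by move=> Vy; apply: (Urysohn_sub1 sepx); exists y.
  (* [1 - f] is 1 at [x] and vanishes off [V], hence on [A], which [V] misses. *)
  have f_cts : continuous (fun y => 1 - f y).
    move=> y; apply: (@cvgB _ R^o); first exact: cvg_cst.
    exact: (@Urysohn_continuous X R).
  pose g : continuousType X R := mkcts f_cts.
  have gE y : g y = 1 - f y by [].
  exists g; split; first by exists x; rewrite gE fx0 subr0.
  apply: AU; apply/CballP => //; exists 0; split => // y Ay.
  rewrite gE zeroE fV1 ?subrr ?normr0// => Vy.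
  by have : (V `&` A) y by []; rewrite VA.
have [B [BF Bcount zeroB]] := tight _ _ zeroF.
(* [None] serves the functions outside [B], so no default point of [X] is required. On [B] it is
   excluded, as [oapp] would return 0. *)
have ex (f : C_card X R K) : exists x : option X, B f -> oapp f 0 x = 1.
  have [/BF[x fx]|nBf] := pselect (B f); first by exists (Some x).
  by exists None.
have [p pP] := choice ex.
pose A := [set x | exists2 f, B f & p f = Some x].
have Acount : countable A.
  apply: (@card_le_trans _ _ _ (p @` B)).
    apply: (@inj_subset_card_le _ _ _ _ Some); last by move=> x y _ _ [].
    by move=> _ [x [f Bf fx] <-]; exists f.
  exact: card_le_trans (card_image_le _ _) Bcount.
(* With radius 1, a member of the ball stays below 1 in absolute value on [A], yet each [f] in [B]
   equals 1 at its chosen point of [A]. *)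
have [] := zeroB (Cball zero A 1).
  by apply/nbhs_C_cardP; exists A, 1; split => //; exact: countable_card_lt.
move=> f [Bf /CballP [//|d [_ d1 fd]]].
have := pP _ Bf; case E : (p f) => [x|] /=; last first.
  by move/eqP; rewrite eq_sym oner_eq0.
move=> fx1; have : `|zero x - f x| <= d by apply: fd; exists f.
by rewrite zeroE fx1 sub0r normrN normr1 leNgt d1.
Qed.

End C_card.

Theorem corollary5p3 (R : realType) (X : topologicalType) (K : Type)
    (tychonoffX : tychonoff_space X) (aleph1_le_K : ~ countable [set: K]) :
  [<-> card_separable X K;
       @open (C_card X R K) = @open (C_unif X R)
         :> set (set (continuousType X R));
       completely_metrizable (C_card X R K) R;
       first_countable (C_card X R K);
       frechet_urysohn (C_card X R K);
       sequential (C_card X R K);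
       countably_tight (C_card X R K)].
Proof.
tfae.
- exact: separable_open_C_card.
- exact: open_C_card_completely_metrizable.
- exact: completely_metrizable_first_countable.
- exact: first_countable_frechet_urysohn.
- exact: frechet_urysohn_sequential.
- exact: sequential_countably_tight.
- exact: countably_tight_separable.
Qed.
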